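(* Let $n\ge 1$ be an integer, and let $p,\alpha,\lambda$ be real numbers such that either ($p>1$ and $0<\alpha<\frac{n+2}{2p}$) or ($p=1$ and $0<\alpha\le\frac{n+2}{2p}$), and such that $\lambda>1$ and $0<\alpha<\frac{n+2}{2p}\left(1-\frac1\lambda\right)$. Let $$q\in\left[\frac{n+2}{2\alpha}\left(1-\frac1\lambda\right),\infty\right].$$ Then there exist $u\in Y^p_\alpha$ satisfying $$0\le(\partial_t-\Delta)^\alpha u\le u^\lambda\quad\text{in }\mathbb{R}^n\times\mathbb{R},\qquad u=0\quad\text{in }\mathbb{R}^n\times(-\infty,0)$$ and a sequence $\{t_j\}\subset(1,\infty)$ such that $$\lim_{j\to\infty}t_j=\infty$$ and $$\|u^\lambda\|_{L^q(R_j)}=\|(\partial_t-\Delta)^\alpha u\|_{L^q(R_j)}=\infty\quad\text{for }j=1,2,\ldots,$$ where $$R_j=\{(x,t)\in\mathbb{R}^n\times\mathbb{R}:|x|<\sqrt{t_j}\text{ and }t_j<t<2t_j\}.$$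
   Context: For $\alpha>0$ and $(x,t)\in\mathbb{R}^n\times\mathbb{R}$ let $$\Phi_\alpha(x,t)=\frac{t^{\alpha-1}}{\Gamma(\alpha)}\frac{1}{(4\pi t)^{n/2}}e^{-|x|^2/(4t)}\chi_{(0,\infty)}(t)$$ and $$J_\alpha f(x,t)=\iint_{\mathbb{R}^n\times(-\infty,t)}\Phi_\alpha(x-\xi,t-\tau)f(\xi,\tau)\,d\xi\,d\tau .$$ For $T\in\mathbb{R}$ put $\mathbb{R}_T=(-\infty,T)$. $X^p=\bigcap_{T\in\mathbb{R}}L^p(\mathbb{R}^n\times\mathbb{R}_T)$ is the set of all measurable $f:\mathbb{R}^n\times\mathbb{R}\to\mathbb{R}$ with $\|f\|_{L^p(\mathbb{R}^n\times\mathbb{R}_T)}<\infty$ for all $T\in\mathbb{R}$, and $Y^p_\alpha=J_\alpha(X^p)$. Functions equal almost everywhere are identified, and (in)equalities between elements of these spaces are understood almost everywhere. When ($p>1$ and $0<\alpha<\frac{n+2}{2p}$) or ($p=1$ and $0<\alpha\le\frac{n+2}{2p}$), the integral defining $J_\alpha f$ yields a real-valued measurable function for each $f\in X^p$, the operator $J_\alpha:X^p\to Y^p_\alpha$ is one-to-one and onto, and $(\partial_t-\Delta)^\alpha:Y^p_\alpha\to X^p$ is defined to be its inverse. Since $(\partial_t-\Delta)^\alpha u\ge0$ forces $u\ge0$, the power $u^\lambda$ is meaningful. *)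

(* Defs.v *)
From HB Require Import structures.
From mathcomp Require Import all_boot all_order all_algebra.
From mathcomp Require Import all_classical all_reals all_analysis.

Set Implicit Arguments.
Unset Strict Implicit.
Unset Printing Implicit Defensive.

Import Order.TTheory GRing.Theory Num.Theory.
Import numFieldNormedType.Exports.

Local Open Scope classical_set_scope.
Local Open Scope ring_scope.

(* Points of R^n are n-tuples, with the Borel (product) sigma-algebra. *)
Notation Rn R n := (n.-tuple (measurableTypeR R)).
Notation Rnt R n := (Rn R n * measurableTypeR R)%type.

Section lebesgue_Rn.
Variable R : realType.
Local Open Scope ereal_scope.

Definition cons_Rn n (z : measurableTypeR R * Rn R n) : Rn R n.+1 :=
  [tuple of z.1 :: z.2].

Lemma measurable_cons_Rn n : measurable_fun setT (@cons_Rn n).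
Proof. by apply: measurable_cons; [exact: measurable_fst|exact: measurable_snd]. Qed.

Definition uncons_Rn n (x : Rn R n.+1) : measurableTypeR R * Rn R n :=
  (thead x, [tuple of behead x]).

Lemma cons_RnK n : cancel (@cons_Rn n) (@uncons_Rn n).
Proof. by move=> [a x]; rewrite /uncons_Rn theadE; congr pair; exact/val_inj. Qed.

Lemma measurable_uncons_Rn n : measurable_fun setT (@uncons_Rn n).
Proof.
apply: measurable_fun_pair; last exact: measurable_behead.
exact: measurable_tnth.
Qed.

Section step.
Variables (n : nat) (m : {sigma_finite_measure set (Rn R n) -> \bar R}).

Definition lebesgue_step : set (Rn R n.+1) -> \bar R :=
  pushforward (lebesgue_measure \x m) (@cons_Rn n).

Let ls0 : lebesgue_step set0 = 0.
Proof. by rewrite /lebesgue_step /pushforward preimage_set0 measure0. Qed.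

Let ls_ge0 A : 0 <= lebesgue_step A.
Proof. by rewrite /lebesgue_step /pushforward; exact: measure_ge0. Qed.

Let ls_sigma_additive : semi_sigma_additive lebesgue_step.
Proof.
move=> F mF tF mUF; rewrite /lebesgue_step /pushforward preimage_bigcup.
have mcF A : measurable A -> measurable (@cons_Rn n @^-1` A).
  by move=> mA; rewrite -[X in measurable X]setTI; exact: measurable_cons_Rn.
apply: measure_semi_sigma_additive.
- by move=> k; exact: mcF.
- apply/trivIsetP => /= i j _ _ ij; rewrite -preimage_setI.
  by move/trivIsetP : tF => /(_ _ _ _ _ ij) ->//; rewrite preimage_set0.
- by rewrite -preimage_bigcup; exact: mcF.
Qed.

HB.instance Definition _ := isMeasure.Build _ _ _ lebesgue_step
  ls0 ls_ge0 ls_sigma_additive.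

Let ls_sigma_finite : sigma_finite setT lebesgue_step.
Proof.
have /sigma_finiteP[F [TF ndF Foo]] := sigma_finiteT (@lebesgue_measure R).
have /sigma_finiteP[G [TG ndG Goo]] := sigma_finiteT m.
exists (fun k => @uncons_Rn n @^-1` (F k `*` G k)).
  rewrite -preimage_bigcup (_ : \bigcup_k (F k `*` G k) = setT) ?preimage_setT//.
  apply/seteqP; split => // -[x y] _.
  have [k _ Fk] : (\bigcup_k F k) x by rewrite -TF.
  have [l _ Gl] : (\bigcup_k G k) y by rewrite -TG.
  exists (maxn k l) => //; split => /=.
  - by move: x Fk; exact/subsetPset/ndF/leq_maxl.
  - by move: y Gl; exact/subsetPset/ndG/leq_maxr.
move=> k; have [mF Fk] := Foo k; have [mG Gk] := Goo k; split.
  rewrite -[X in measurable X]setTI; apply: measurable_uncons_Rn => //.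
  exact: measurableX.
rewrite /lebesgue_step /pushforward -comp_preimage.
rewrite (_ : _ \o _ = idfun); last by apply/funext => z; exact: cons_RnK.
rewrite preimage_id product_measure1E// lte_mul_pinfty// ge0_fin_numE//.
Qed.

HB.instance Definition _ := Measure_isSigmaFinite.Build _ _ _ lebesgue_step
  ls_sigma_finite.

End step.

(* n-dimensional Lebesgue measure: the n-fold product of the one-dimensional
   one, transported along R * R^n ~ R^n.+1; on the one-point space R^0 it is the
   unit mass. *)
Fixpoint lebesgue_Rn n : {sigma_finite_measure set (Rn R n) -> \bar R} :=
  match n with
  | 0%N => \d_([tuple] : Rn R 0)
  | n'.+1 => lebesgue_step (lebesgue_Rn n')
  end.

Lemma lebesgue_Rn_box n (A : 'I_n -> set (measurableTypeR R)) :
  (forall i, measurable (A i)) ->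
  lebesgue_Rn n [set x : Rn R n | forall i, A i (tnth x i)] =
  \prod_(i < n) lebesgue_measure (A i).
Proof.
elim: n A => [A _|n IH A mA].
  by rewrite big_ord0 /= diracE mem_set// => -[].
rewrite big_ord_recl -IH// -product_measure1E//=; last first.
  have -> : [set x : Rn R n | forall i, A (lift ord0 i) (tnth x i)] =
      \bigcap_(i in [set: 'I_n]) ((fun x => tnth x i) @^-1` A (lift ord0 i)).
    by apply/seteqP; split => [x Ax i _|x Ax i]; exact: Ax.
  apply: fin_bigcap_measurable => // i _.
  by rewrite -[X in measurable X]setTI; exact: measurable_tnth.
rewrite /lebesgue_step /pushforward; congr (_ _).
apply/seteqP; split => -[a x] /=.
  move=> Ax; split; first by have := Ax ord0; rewrite tnth0.
  by move=> i; have := Ax (lift ord0 i); rewrite tnthS.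
move=> [Aa Ax] i; case: (unliftP ord0 i) => [j ->|->]; last by rewrite tnth0.
by rewrite tnthS; exact: Ax.
Qed.

Definition lebesgue_Rnt n : {measure set (Rnt R n) -> \bar R} :=
  lebesgue_Rn n \x lebesgue_measure.

End lebesgue_Rn.

Section fractional_heat.
Variable R : realType.
Implicit Types (n : nat) (p alpha : R).

Definition enorm n (x : Rn R n) : R :=
  Num.sqrt (\sum_(i < n) (tnth x i : R) ^+ 2).

Definition subRn n (x y : Rn R n) : Rn R n :=
  [tuple (tnth x i - tnth y i : R) | i < n].

(* R^n x (-oo, T) *)
Definition before n (T : R) : set (Rnt R n) := [set z | (z.2 : R) < T].

Definition Gamma (a : R) : R :=
  \int[lebesgue_measure]_(s in `]0, +oo[) (s `^ (a - 1) * expR (- s)).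

Definition Phi n alpha (x : Rn R n) (t : R) : R :=
  if 0 < t then
    t `^ (alpha - 1) / Gamma alpha * ((4 * pi * t) `^ (n%:R / 2))^-1
      * expR (- (enorm x ^+ 2 / (4 * t)))
  else 0.

(* Extended-real valued: J f z is finite exactly when the integrand is
   integrable, so that nothing is hidden by a default value. *)
Definition J n alpha (f : Rnt R n -> R) (z : Rnt R n) : \bar R :=
  \int[lebesgue_Rnt R n]_(w in before z.2)
    (Phi alpha (subRn z.1 w.1) (z.2 - w.2 : R) * f w)%:E.

(* ||f||_{L^q(D)} as the norm of f extended by 0 off D, for 0 < q <= +oo. *)
Definition LnormOn n (q : \bar R) (D : set (Rnt R n)) (f : Rnt R n -> R)
    : \bar R :=
  Lnorm (lebesgue_Rnt R n) q (EFin \o (f \_ D)).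

Definition Xspace n p : set (Rnt R n -> R) :=
  [set f | measurable_fun setT f /\
    forall T : R, (LnormOn p%:E (before T) f < +oo)%E].

(* Functions equal almost everywhere are identified, so an equality u = J f
   between elements of the spaces below is an equality almost everywhere. *)
Definition ae_J n alpha (f u : Rnt R n -> R) : Prop :=
  {ae lebesgue_Rnt R n, forall z, (u z)%:E = J alpha f z}.

Definition Yspace n p alpha : set (Rnt R n -> R) :=
  [set u | measurable_fun setT u /\ exists2 f, Xspace p f & ae_J alpha f u].

(* [fracHeat p alpha u f] is the graph of (d_t - Delta)^alpha : Y -> X, the
   inverse of J alpha : X -> Y: it says that (d_t - Delta)^alpha u = f. It is
   a relation because u and f only represent their classes modulo equality
   almost everywhere. *)
Definition fracHeat n p alpha (u f : Rnt R n -> R) : Prop :=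
  [/\ Yspace p alpha u, Xspace p f & ae_J alpha f u].

Definition parabolicBox n (t : R) : set (Rnt R n) :=
  [set z | enorm z.1 < Num.sqrt t /\ t < z.2 < 2 * t].

End fractional_heat.

(* Main.v *)
Require Import Defs.
From HB Require Import structures.
From mathcomp Require Import all_boot all_order all_algebra.
From mathcomp Require Import all_classical all_reals all_analysis.
From mathcomp Require Import measurable_realfun ess_sup_inf lra ring.

(** The proof exhibits a self-similar source with a singularity at the points
    [(0, j)], one for each natural number [j].

    Let [b = alpha * lambda / (lambda - 1)]. On the paraboloid with vertex
    [(0, j)] and time span 1, let [f = M * s ^ (- b)], where [s] is the time
    elapsed since the vertex; elsewhere [f = 0]. The operator [J] gains [alpha]
    powers of [s]: integrating the heat kernel over the part of the paraboloid
    at distance comparable to [s] in time and [sqrt s] in space gives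
    [J f >= c * M * s ^ (alpha - b)] on the paraboloid, with [c > 0]
    ([J_source_ge]). The exponent [b] is the one for which
    [lambda * (alpha - b) = - b], so [(J f) ^ lambda] dominates
    [(c * M) ^ lambda * s ^ (- b)]. This equals [f] if [(c * M) ^ lambda = M],
    which determines [M] because [lambda] is not 1. Hence [u = J f] satisfies
    [0 <= f <= u ^ lambda].

    The section of a paraboloid at time [s] has volume of order [s ^ (n / 2)],
    so the integral of [f ^ r] over a unit time slab is a constant times that of
    [s ^ (n / 2 - b * r)] over the unit interval ([integral_source_slab]). It is
    finite if and only if [b * r < (n + 2) / 2]. The upper bound on [alpha]
    says precisely that this holds for [r = p], so [f] lies in [X^p]; and
    [b * q0 = (n + 2) / 2] for the least admissible exponent [q0], so the
    integral diverges for all finite [r >= q0]. As the paraboloid at [j + 2]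
    lies in the parabolic box of parameter [t_j = j + 2], the norms of [f],
    and with it of [u ^ lambda], are infinite there; the case [q = +oo] follows
    by interpolation against [p] ([LnormOn_infty]).

    What remains is that [J f] is finite almost everywhere, which is Tonelli's
    theorem combined with the explicit mass of the heat kernel ([J_ae_lty]). *)

Set Implicit Arguments.
Unset Strict Implicit.
Unset Printing Implicit Defensive.

Import Order.TTheory GRing.Theory Num.Theory.
Import numFieldNormedType.Exports.

Local Open Scope classical_set_scope.
Local Open Scope ring_scope.

(** * Integrals of powers near a singularity *)

Section power_integrals.
Context {R : realType}.
Notation mu := (@lebesgue_measure R).
Implicit Types a A B : R.

(** The integrands below are singular at [A], so the fundamental theorem of
    calculus is applied only on closed intervals to the right of [A]. *)
Lemma FTC2_right_ray (F f : R -> R) A x y :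
  (forall z, A < z -> is_derive z 1 F (f z)) ->
  (forall z, A < z -> {for z, continuous f}) ->
  A < x -> x < y ->
  (\int[mu]_(t in `[x, y]) (f t)%:E = (F y - F x)%:E)%E.
Proof.
move=> dF cf Ax xy.
have cF z : A < z -> {for z, continuous F}.
  move=> Az; have [dFz _] := dF _ Az.
  by apply/differentiable_continuous/derivable1_diffP.
rewrite (@continuous_FTC2 _ f F)//.
- apply: continuous_in_subspaceT => z; rewrite inE/= in_itv/= => /andP[xz _].
  by apply: cf; exact: lt_le_trans xz.
- split.
  + move=> z; rewrite in_itv/= => /andP[xz _].
    by have [] := dF z (lt_trans Ax xz).
  + by apply: cvg_at_right_filter; exact: cF.
  + by apply: cvg_at_left_filter; apply: cF; exact: lt_trans xy.
- move=> z; rewrite in_itv/= => /andP[xz _].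
  by have [_] := dF z (lt_trans Ax xz); rewrite derive1E.
Qed.

Lemma is_derive_powR_shift a A x : A < x ->
  is_derive x 1 (fun t => (t - A) `^ a) (a * (x - A) `^ (a - 1)).
Proof.
move=> Ax; have xA0 : 0 < x - A by rewrite subr_gt0.
have dB : is_derive x 1 (fun t : R => t - A) 1.
  by rewrite -[X in is_derive _ _ _ X]subr0; exact: is_deriveB.
by have := @is_derive1_comp _ (fun y : R => y `^ a) (fun t => t - A) _ _ _
  (is_derive1_powR a xA0) dB; rewrite mulr1.
Qed.

Lemma continuous_powR_shift a A x : A < x ->
  {for x, continuous (fun t => (t - A) `^ a)}.
Proof.
move=> Ax; apply/differentiable_continuous/derivable1_diffP.
by have [] := is_derive_powR_shift a Ax.
Qed.

Lemma measurable_powR_shift a A (D : set R) :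
  measurable_fun D (fun t : R => (t - A) `^ a).
Proof.
apply: measurable_funTS.
have h : measurable_fun setT (fun t : R => t - A) by exact: measurable_funB.
exact: (measurableT_comp (measurable_powR a) h).
Qed.

Lemma itv_open_bigcup A B : A < B ->
  [set` `]A, B]] = \bigcup_k [set` `[A + (B - A) / k.+2%:R, B]] :> set R.
Proof.
move=> AB; apply/seteqP; split => x /=; rewrite in_itv/=.
  move=> /andP[Ax xB].
  exists (Num.truncn ((B - A) / (x - A))) => //=.
  rewrite in_itv/= xB andbT -lerBrDl ler_pdivrMr ?ltr0n// mulrC.
  rewrite -ler_pdivrMr ?subr_gt0//.
  apply: ltW; apply: lt_le_trans (truncnS_gt _) _.
  by rewrite ler_nat.
move=> [k _ /=]; rewrite in_itv/= => /andP[Ax ->]; rewrite andbT.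
by apply: lt_le_trans Ax; rewrite ltrDl divr_gt0 ?subr_gt0 ?ltr0n.
Qed.

(** Let the left end of the interval decrease to the singularity in the
    primitive [(t - A) ^ (a + 1) / (a + 1)]. *)
Lemma integral_powR_le a A B : -1 < a -> A < B ->
  (\int[mu]_(t in `[A, B[) ((t - A) `^ a)%:E
    <= ((B - A) `^ (a + 1) / (a + 1))%:E)%E.
Proof.
move=> a1 AB.
have a10 : 0 < a + 1 by rewrite -ltrBlDr sub0r.
have mf D : measurable_fun D (fun t : R => ((t - A) `^ a)%:E).
  by apply/measurable_EFinP; exact: measurable_powR_shift.
rewrite (integral_itv_bndoo true true); last exact: mf.
rewrite -(integral_itv_bndoo false false); last exact: mf.
rewrite itv_open_bigcup//.
pose F k := [set` `[A + (B - A) / k.+2%:R, B]].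
have dpos k : 0 < (B - A) / k.+2%:R by rewrite divr_gt0 ?subr_gt0 ?ltr0n.
have ndF : nondecreasing_seq F.
  apply/nondecreasing_seqP => k; rewrite subsetEset => x/=.
  rewrite /F /= !in_itv/= => /andP[h ->]; rewrite andbT.
  apply: le_trans h; rewrite lerD2l ler_pM2l ?subr_gt0// lef_pV2 ?posrE//.
  by rewrite ler_nat.
have mF k : measurable (F k) by exact: measurable_itv.
have mfF k : measurable_fun (F k) (fun t : R => ((t - A) `^ a)%:E) := mf (F k).
have f0 k (t : R) : F k t -> (0 <= ((t - A) `^ a)%:E)%E.
  by rewrite lee_fin powR_ge0.
have := ge0_nondecreasing_set_cvg_integral (mu := mu) ndF mF mfF f0.
move=> /cvg_lim <- //; apply: lime_le.
  apply: ereal_nondecreasing_is_cvgn.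
  exact: ge0_nondecreasing_set_nondecreasing_integral.
apply: nearW => k.
have dF z : A < z -> is_derive z 1
    (fun t => (a + 1)^-1 * (t - A) `^ (a + 1)) ((z - A) `^ a).
  move=> Az; apply: is_derive_eq.
    exact: (is_deriveZ _ (is_derive_powR_shift (a + 1) Az)).
  by rewrite addrK /GRing.scale/= mulrA mulVf ?mul1r// gt_eqF.
rewrite (FTC2_right_ray dF) ?ltrDl//.
- rewrite lee_fin mulrC gerBl mulr_ge0 ?powR_ge0// invr_ge0; exact: ltW.
- by move=> z Az; exact: continuous_powR_shift.
- rewrite -ltrBrDl ltr_pdivrMr ?ltr0n// ltr_pMr ?subr_gt0//.
  by rewrite (ltr_nat _ 1).
Qed.

(** On an interval of length 1 the power is at least [(t - A) ^ -1], whose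
    primitive is the unbounded function [ln (t - A)]. *)
Lemma integral_powR_infty a A : a <= -1 ->
  (\int[mu]_(t in `[A, (A + 1)%R[) ((t - A) `^ a)%:E = +oo)%E.
Proof.
move=> a1; apply/eqyP => M M0.
have mf D : measurable_fun D (fun t : R => ((t - A) `^ a)%:E).
  by apply/measurable_EFinP; exact: measurable_powR_shift.
rewrite (integral_itv_bndoo true true); last exact: mf.
rewrite -(integral_itv_bndoo false false); last exact: mf.
(* Cutting at distance 1 / (k + 2) from A leaves ln (k + 2) >= M. *)
pose k := Num.truncn (expR M).
have k0 : (0 : R) < k.+2%:R^-1 by rewrite invr_gt0 ltr0n.
apply: (@le_trans _ _
    (\int[mu]_(t in `[(A + k.+2%:R^-1)%R, (A + 1)%R]) ((t - A) `^ (-1))%:E)%E).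
  have dF z : A < z -> is_derive z 1 (fun t => ln (t - A)) ((z - A) `^ (-1)).
    move=> Az; have zA0 : 0 < z - A by rewrite subr_gt0.
    have dB : is_derive z 1 (fun t : R => t - A) 1.
      by rewrite -[X in is_derive _ _ _ X]subr0; exact: is_deriveB.
    by have := @is_derive1_comp _ _ (fun t => t - A) _ _ _
      (is_derive1_ln zA0) dB; rewrite mulr1 powR_inv1 ?ltW.
  rewrite (FTC2_right_ray dF) ?ltrDl//.
  - rewrite (addrC A 1) addrK (addrC A) addrK ln1 sub0r lnV ?posrE ?ltr0n//.
    rewrite opprK lee_fin -(@ler_expR R) lnK ?posrE ?ltr0n//.
    apply: ltW; apply: lt_le_trans (truncnS_gt _) _.
    by rewrite ler_nat.
  - by move=> z Az; exact: continuous_powR_shift.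
  - by rewrite ltrD2l invf_lt1 ?ltr0n// (ltr_nat _ 1).
apply: (@le_trans _ _
    (\int[mu]_(t in `[(A + k.+2%:R^-1)%R, (A + 1)%R]) ((t - A) `^ a)%:E)%E).
  apply: ge0_le_integral => //.
  - by move=> t _; rewrite lee_fin powR_ge0.
  - by apply/measurable_EFinP; exact: measurable_powR_shift.
  - exact: mf.
  - move=> t; rewrite /= in_itv/= => /andP[h1 h2].
    rewrite lee_fin ger_powR//; apply/andP; split; last by rewrite lerBlDl.
    by rewrite subr_gt0; apply: lt_le_trans h1; rewrite ltrDl.
apply: ge0_subset_integral => //.
- exact: mf.
- by move=> t _; rewrite lee_fin powR_ge0.
- move=> t /=; rewrite !in_itv/= => /andP[h1 ->]; rewrite andbT.
  by apply: lt_le_trans h1; rewrite ltrDl.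
Qed.

End power_integrals.

(** * The Gamma integral *)

Section Gamma_function.
Context {R : realType}.
Notation mu := (@lebesgue_measure R).

(** Apply [x <= expR x] at [x = s / (2 * a)] and raise to the power [a]. *)
Lemma powR_le_expR (a s : R) : 0 < a -> 0 <= s ->
  s `^ a <= (2 * a) `^ a * expR (s / 2).
Proof.
move=> a0 s0; have a20 : 0 < 2 * a by rewrite mulr_gt0.
have {1}-> : s = 2 * a * (s / (2 * a)) by rewrite mulrC mulfVK ?gt_eqF.
rewrite [leLHS]powRM ?(ltW a20) ?divr_ge0 ?(ltW a20)// ler_pM2l ?powR_gt0//.
have -> : expR (s / 2) = expR (s / (2 * a)) `^ a.
  rewrite -expRM; congr expR; field; rewrite gt_eqF//.
apply: ge0_ler_powR => //; rewrite ?nnegrE ?(ltW a0) ?divr_ge0 ?expR_ge0//.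
  exact: ltW.
by apply: le_trans (expR_ge1Dx _); rewrite lerDr.
Qed.

(** [Gamma] is the real number underlying an extended-real integral, 0 if that
    is infinite, so its positivity also says that the integral converges: near 0
    by comparison with [s ^ (a - 1)], near infinity by comparison with an
    exponential density. *)
Lemma Gamma_gt0 (a : R) : 0 < a -> 0 < Gamma a.
Proof.
move=> a0; rewrite /Gamma /Rintegral.
set F := fun s : R => (s `^ (a - 1) * expR (- s))%:E.
have F0 s : (0 <= F s)%E by rewrite lee_fin mulr_ge0 ?powR_ge0 ?expR_ge0.
have mF D : measurable_fun D F.
  apply/measurable_EFinP; apply: measurable_funM.
    by apply: measurable_funTS; exact: measurable_powR.
  by apply: measurable_funTS; exact: measurableT_comp.
apply: fine_gt0; apply/andP; split.
- (* On [1, 2] the integrand is at least s^-1 * exp (- s). *)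
  apply: (@lt_le_trans _ _
      (\int[mu]_(s in `[1%R, 2%R]) (2^-1 * expR (- 2))%:E)%E).
    rewrite integral_cst//= lebesgue_measure_itv/= lte_fin ltr1n -EFinB.
    by rewrite -EFinM lte_fin mulr_gt0 ?mulr_gt0 ?invr_gt0 ?expR_gt0//; lra.
  apply: (@le_trans _ _ (\int[mu]_(s in `[1%R, 2%R]) F s)%E).
    apply: ge0_le_integral => //.
    - exact: mF.
    - move=> s /=; rewrite in_itv/= => /andP[s1 s2].
      rewrite lee_fin ler_pM ?invr_ge0 ?expR_ge0 ?ler_expR ?lerN2//.
      have s0 : 0 < s by apply: lt_le_trans s1.
      have sa : 1 <= s `^ a by rewrite -(powRr0 s) ler_powR// ltW.
      rewrite powRB; last by rewrite (gt_eqF s0) implybT.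
      rewrite powRr1 ?(ltW s0)// -[leLHS]mul1r ler_pM ?invr_ge0//.
      by rewrite lef_pV2 ?posrE.
  apply: ge0_subset_integral => //; first exact: mF.
  by move=> s /=; rewrite !in_itv/= andbT => /andP[s1 _]; exact: lt_le_trans s1.
- rewrite (_ : [set` `]0, +oo[] =
      [set` `]0, 1[] `|` [set` `[1, +oo[])%R; last first.
    apply/seteqP; split => s /=; rewrite !in_itv/= !andbT.
      by move=> ->/=; case: ltP; [left|right].
    by case=> [/andP[]//|]; exact: lt_le_trans.
  rewrite ge0_integral_setU//; last 3 first.
  + exact: mF.
  + by move=> s _; exact: F0.
  +
    apply/disj_setPS => s /= []; rewrite !in_itv/= andbT => /andP[_ s1].
    by rewrite leNgt s1.
  apply: lte_add_pinfty; rewrite -/F.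
  + apply: (@le_lt_trans _ _
        (\int[mu]_(s in `[0%R, 1%R[) ((s - 0) `^ (a - 1))%:E)%E).
      apply: (@le_trans _ _
          (\int[mu]_(s in `]0%R, 1%R[) ((s - 0) `^ (a - 1))%:E)%E).
        apply: ge0_le_integral => //.
        * by move=> s _; exact: F0.
        * exact: mF.
        * by apply/measurable_EFinP; exact: measurable_powR_shift.
        * move=> s /=; rewrite in_itv/= => /andP[s0 _].
          rewrite lee_fin subr0 ler_piMr ?powR_ge0//.
          by rewrite -expR0 ler_expR oppr_le0 ltW.
      apply: ge0_subset_integral => //.
      * by apply/measurable_EFinP; exact: measurable_powR_shift.
      * by move=> s _; rewrite lee_fin powR_ge0.
      * by move=> s /=; rewrite !in_itv/= => /andP[/ltW -> ->].
    apply: (le_lt_trans (integral_powR_le _ _)); rewrite ?ltr01 ?ltry//.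
    by rewrite ltrBrDl subrr.
  + pose c := 2 * (2 * a) `^ a.
    have c0 : 0 <= c by rewrite mulr_ge0 ?powR_ge0.
    have mexp D : measurable_fun D (fun s : R => (exponential_pdf 2^-1 s)%:E).
      apply/measurable_EFinP; apply: measurable_funTS.
      exact: measurable_exponential_pdf.
    have exp0 s : (0 <= (exponential_pdf 2^-1 s : R)%:E)%E.
      by rewrite lee_fin exponential_pdf_ge0.
    apply: (@le_lt_trans _ _
        (\int[mu]_(s in `[1%R, +oo[) (c%:E * (exponential_pdf 2^-1 s)%:E))%E).
      apply: ge0_le_integral => //.
      * by move=> s _; exact: F0.
      * exact: mF.
      * by apply: measurable_funeM; exact: mexp.
      * move=> s /=; rewrite in_itv/= andbT => s1.
        have s0 : 0 <= s by apply: le_trans s1.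
        rewrite exponential_pdfE// -EFinM lee_fin /c.
        apply: (@le_trans _ _ (s `^ a * expR (- s))).
          by rewrite ler_wpM2r ?expR_ge0// ler_powR// gerBl.
        apply: (@le_trans _ _ ((2 * a) `^ a * expR (s / 2) * expR (- s))).
          by rewrite ler_wpM2r ?expR_ge0// powR_le_expR.
        rewrite -mulrA -expRD mulrACA mulfV// mul1r.
        by rewrite (_ : s / 2 - s = - 2^-1 * s)//; field.
    rewrite ge0_integralZl//; last exact: mexp.
    apply: (@le_lt_trans _ _ (c%:E * 1)%E); last by rewrite mule1 ltry.
    rewrite lee_wpmul2l ?lee_fin// -(@integral_exponential_pdf R 2^-1)//.
    by apply: ge0_subset_integral => //; exact: mexp.
Qed.

End Gamma_function.

(** * Product integrands and the heat kernel on R^n *)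

Section integrals_on_Rn.
Context {R : realType}.
Notation mu := (@lebesgue_measure R).

Lemma measurable_prod_tnth n (g : 'I_n -> R -> R) :
  (forall i, measurable_fun setT (g i)) ->
  measurable_fun setT (fun x : Rn R n => \prod_(i < n) g i (tnth x i)).
Proof.
move=> mg; apply: measurable_prod => i _.
by apply: (measurableT_comp (mg i)); exact: measurable_tnth.
Qed.

Lemma integral_prod_tnth n (g : 'I_n -> R -> R) :
  (forall i, measurable_fun setT (g i)) -> (forall i x, 0 <= g i x) ->
  (\int[lebesgue_Rn R n]_x (\prod_(i < n) g i (tnth x i))%:E =
   \prod_(i < n) \int[mu]_x (g i x)%:E)%E.
Proof.
elim: n g => [|n IH] g mg g0.
  rewrite big_ord0 /= integral_dirac//.
    by rewrite diracE mem_set// mul1e big_ord0.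
  by apply/measurable_EFinP; exact: measurable_prod_tnth.
pose G (x : Rn R n.+1) := (\prod_(i < n.+1) g i (tnth x i))%:E.
have mG : measurable_fun setT G.
  by apply/measurable_EFinP; exact: measurable_prod_tnth.
have G0 x : (0 <= G x)%E by rewrite lee_fin prodr_ge0.
transitivity
  (\int[pushforward (mu \x lebesgue_Rn R n) (@cons_Rn R n)]_x G x)%E.
  by apply: eq_measure_integral; [exact: measurable_cons_Rn|move=> *].
rewrite ge0_integral_pushforward//; last exact: measurable_cons_Rn.
rewrite preimage_setT fubini_tonelli1//; last 2 first.
- exact: (measurableT_comp mG (@measurable_cons_Rn R n)).
- by move=> z; exact: G0.
pose g' i := g (lift ord0 i).
have mg' : measurable_fun setT
    (fun y : Rn R n => \prod_(i < n) g' i (tnth y i)).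
  by apply: measurable_prod_tnth => i; exact: mg.
transitivity (\int[mu]_x ((g ord0 x)%:E *
    \int[lebesgue_Rn R n]_y (\prod_(i < n) g' i (tnth y i))%:E))%E.
  apply: eq_integral => x _; rewrite /fubini_F -ge0_integralZl//.
  - apply: eq_integral => y _; rewrite /G /= big_ord_recl -EFinM tnth0.
    by congr (_ * _)%:E; apply: eq_bigr => i _; rewrite tnthS.
  - by apply/measurable_EFinP.
  - by move=> y _; rewrite lee_fin prodr_ge0// => i _; exact: g0.
  - by rewrite lee_fin.
rewrite ge0_integralZr//; last 3 first.
- by apply/measurable_EFinP; exact: mg.
- by move=> x _; rewrite lee_fin.
- by apply: integral_ge0 => y _; rewrite lee_fin prodr_ge0// => i _; exact: g0.
rewrite big_ord_recl; congr (_ * _)%E.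
by apply: IH => i *; [exact: mg|exact: g0].
Qed.

(** Up to the factor in [s], the heat kernel is a product of one-dimensional
    normal densities of variance [2 * s], which is how its mass is computed. *)
Lemma PhiE n alpha (x y : Rn R n) s : 0 < s ->
  Phi alpha (subRn x y) s = s `^ (alpha - 1) / Gamma alpha *
    \prod_(i < n) normal_pdf (tnth y i) (Num.sqrt (2 * s)) (tnth x i).
Proof.
move=> s0; rewrite /Phi s0 -mulrA; congr (_ * _).
have s20 : 0 < 2 * s by rewrite mulr_gt0.
have sE : Num.sqrt (2 * s) ^+ 2 = 2 * s by rewrite sqr_sqrtr// ltW.
under eq_bigr => i _ do rewrite normal_pdfE ?gt_eqF ?sqrtr_gt0//.
rewrite big_split/= prodr_const card_ord /normal_peak sE.
congr (_ * _).
  rewrite exprVn; congr (_^-1).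
  rewrite [n%:R / 2]mulrC powRrM powR_mulrn ?powR_ge0//.
  rewrite powR12_sqrt ?mulr_ge0 ?pi_ge0 ?ltW//.
  by congr (Num.sqrt _ ^+ _); rewrite -mulr_natr; ring.
rewrite -expR_sum; congr expR.
rewrite /enorm sqr_sqrtr; last by apply: sumr_ge0 => i _; exact: sqr_ge0.
rewrite -mulNr -sumrN mulr_suml; apply: eq_bigr => i _.
by rewrite tnth_mktuple sE -mulr_natr; congr (_ / _); ring.
Qed.

Lemma integral_Phi n alpha (y : Rn R n) s : 0 < alpha -> 0 < s ->
  (\int[lebesgue_Rn R n]_x (Phi alpha (subRn x y) s)%:E =
    (s `^ (alpha - 1) / Gamma alpha)%:E)%E.
Proof.
move=> alpha0 s0; under eq_integral do rewrite PhiE// EFinM.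
have sg : Num.sqrt (2 * s) != 0 by rewrite gt_eqF// sqrtr_gt0 mulr_gt0.
rewrite ge0_integralZl//; last 3 first.
- apply/measurable_EFinP; apply: (@measurable_prod_tnth n
    (fun i => normal_pdf (tnth y i) (Num.sqrt (2 * s)))) => i.
  exact: measurable_normal_pdf.
- by move=> x _; rewrite lee_fin prodr_ge0// => i _; exact: normal_pdf_ge0.
- by rewrite lee_fin divr_ge0 ?powR_ge0// ltW// Gamma_gt0.
rewrite (@integral_prod_tnth n
  (fun i => normal_pdf (tnth y i) (Num.sqrt (2 * s)))).
- by rewrite big1 ?mule1// => i _; exact: integral_normal_pdf.
- by move=> i; exact: measurable_normal_pdf.
- by move=> i x; exact: normal_pdf_ge0.
Qed.

End integrals_on_Rn.

(** * The singular source *)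

Section singular_source.
Context {R : realType}.

(** At nonnegative times, the only ones where it is used, this is the fractional
    part. *)
Definition frac (t : R) : R := t - (Num.truncn t)%:R.

Lemma fracE (j : nat) t : j%:R <= t < j.+1%:R -> frac t = t - j%:R.
Proof.
move=> jt; congr (_ - _%:R); apply/eqP; rewrite truncn_eq//.
by apply: le_trans (andP jt).1; rewrite ler0n.
Qed.

Lemma frac_itv t : 0 <= t -> 0 <= frac t < 1.
Proof.
move=> t0; have := truncn_itv t0; rewrite /frac subr_ge0 => /andP[-> h] /=.
by rewrite ltrBlDl natr1.
Qed.

Lemma measurable_frac : measurable_fun setT frac.
Proof.
apply: measurable_funB => //; apply: nondecreasing_measurable => // x y xy.
by rewrite ler_nat; exact: le_truncn.
Qed.

Definition cube n (rho : R) : set (Rn R n) :=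
  [set x | forall i, `|tnth x i : R| < rho].
Arguments cube : clear implicits.

Lemma cubeE n rho : cube n rho =
  [set x : Rn R n | forall i, [set` `]- rho, rho[] (tnth x i)].
Proof.
by apply/seteqP; split => x cx i; have := cx i; rewrite /= in_itv/= ltr_norml.
Qed.

Lemma measurable_cube n rho : measurable (cube n rho).
Proof.
have -> : cube n rho = \bigcap_(i in [set: 'I_n])
    ((fun x => tnth x i) @^-1` [set` `]- rho, rho[]).
  rewrite cubeE; apply/seteqP; split => [x Ax i _|x Ax i]; exact: Ax.
apply: fin_bigcap_measurable => // i _.
rewrite -[X in measurable X]setTI; exact: measurable_tnth.
Qed.

Lemma lebesgue_Rn_cube n rho : 0 <= rho ->
  lebesgue_Rn R n (cube n rho) = ((2 * rho) ^+ n)%:E.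
Proof.
move=> rho0; rewrite cubeE (@lebesgue_Rn_box R n (fun=> [set` `]- rho, rho[])).
  rewrite (eq_bigr (fun=> (2 * rho)%:E)) => [|i _]; last first.
    rewrite [LHS]lebesgue_measure_itv/= lte_fin opprK mulr_natl mulr2n.
    case: ltP => // h; congr (_%:E); apply/eqP.
    by rewrite eq_le addr_ge0//= -lerBrDr sub0r.
  by rewrite prodEFin prodr_const card_ord.
by move=> i; exact: measurable_itv.
Qed.

(** One copy of a parabolic region issuing from each point [(0, j)], [j] a
    natural number, and filling the time interval from [j] to [j + 1].
    Cross-sections are cubes inscribed in the ball of radius [sqrt s], where
    [s] is the time since the vertex, so that their measure is an explicit
    product. *)
Definition paraboloids n : set (Rnt R n) :=
  [set z | 0 <= (z.2 : R) /\ cube n (Num.sqrt (frac z.2 / n%:R)) z.1].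
Arguments paraboloids : clear implicits.

(** The function [M * s ^ (- b)] on the paraboloids, extended by 0. It is
    homogeneous of parabolic degree [- 2 * b] about each vertex [(0, j)]. *)
Definition source n (M b : R) : Rnt R n -> R :=
  (fun z => M * frac z.2 `^ (- b)) \_ (paraboloids n).

Definition slab n j : set (Rnt R n) := [set z | j%:R <= (z.2 : R) < j.+1%:R].
Arguments slab : clear implicits.

Lemma measurable_frac2 n : measurable_fun setT (fun z : Rnt R n => frac z.2).
Proof. exact: (measurableT_comp measurable_frac measurable_snd). Qed.

Lemma measurable_coord n (i : 'I_n) :
  measurable_fun setT (fun z : Rnt R n => tnth z.1 i : R).
Proof. exact: (measurableT_comp (measurable_tnth i) measurable_fst). Qed.

Lemma measurable_set_ltr d (T : measurableType d) (f g : T -> R) :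
  measurable_fun setT f -> measurable_fun setT g ->
  measurable [set x | f x < g x].
Proof.
move=> mf mg; rewrite -[X in measurable X]setTI.
by apply: (measurable_fun_ltr mf mg measurableT (Y := [set true])).
Qed.

Lemma measurable_sqrt d (T : measurableType d) (f : T -> R) :
  measurable_fun setT f -> measurable_fun setT (fun x => Num.sqrt (f x)).
Proof.
have ms : measurable_fun setT (@Num.sqrt R).
  by apply: nondecreasing_measurable => // x y; exact: ler_wsqrtr.
exact: measurableT_comp.
Qed.

Lemma measurable_paraboloids n : measurable (paraboloids n).
Proof.
have -> : paraboloids n = [set z | 0 <= (z.2 : R)] `&`
    \bigcap_(i in [set: 'I_n])
      [set z : Rnt R n | `|tnth z.1 i : R| < Num.sqrt (frac z.2 / n%:R)].
  by apply/seteqP; split => z [z0 h]; split => // i; [move=> _|]; exact: h.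
apply: measurableI.
  rewrite -[X in measurable X]setTI; apply: measurable_fun_le => //.
apply: fin_bigcap_measurable => // i _.
apply: measurable_set_ltr.
  by apply: measurableT_comp => //; exact: measurable_coord.
apply: measurable_sqrt.
by apply: measurable_funM => //; exact: measurable_frac2.
Qed.

Lemma measurable_source n M b : measurable_fun setT (@source n M b).
Proof.
have mP := @measurable_paraboloids n; apply/(measurable_restrictT _ mP).
apply: measurable_funTS; apply: measurable_funM => //.
by apply: (measurableT_comp (measurable_powR _)); exact: measurable_frac2.
Qed.

Lemma source_ge0 n M b z : 0 <= M -> 0 <= @source n M b z.
Proof.
move=> M0; rewrite /source patchE; case: ifP => // _.
by rewrite mulr_ge0// powR_ge0.
Qed.

Lemma source_lt0 n M b z : (z.2 : R) < 0 -> @source n M b z = 0.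
Proof.
move=> z0; rewrite /source patchE memNset// => -[+ _].
by rewrite leNgt z0.
Qed.

End singular_source.
Arguments cube {R} n rho.
Arguments paraboloids {R} n.
Arguments slab {R} n j.

(** * Integrals of powers of the source *)

Section source_integrals.
Context {R : realType}.
Notation mu := (@lebesgue_measure R).

Lemma measurable_slab n j : measurable (@slab R n j).
Proof.
have -> : @slab R n j = snd @^-1` [set` `[j%:R, j.+1%:R[].
  by apply/seteqP; split => z; rewrite /= in_itv.
by rewrite -[X in measurable X]setTI; apply: measurable_snd.
Qed.

Lemma measurable_before n T : measurable (@before R n T).
Proof.
have -> : @before R n T = snd @^-1` [set` `]-oo, T[].
  by apply/seteqP; split => z; rewrite /= in_itv.
by rewrite -[X in measurable X]setTI; apply: measurable_snd.
Qed.

Lemma measurable_sourceX n (M b r : R) (D : set (Rnt R n)) :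
  measurable_fun D (fun z => (source M b z `^ r)%:E).
Proof.
apply/measurable_EFinP; apply: measurable_funTS.
by apply: (measurableT_comp (measurable_powR r)); exact: measurable_source.
Qed.

(** The section of the paraboloid at time [s] after its vertex is a cube of
    volume [(2 / sqrt n) ^ n * s ^ (n / 2)]. *)
Lemma integral_source_section n (M b r : R) (j : nat) (t : R) :
  0 <= M -> 0 < r -> j%:R < t < j.+1%:R ->
  (\int[lebesgue_Rn R n]_x (source M b (x, t) `^ r)%:E =
   (M `^ r * (2 / Num.sqrt n%:R) ^+ n *
     (t - j%:R) `^ (n%:R / 2 - b * r))%:E)%E.
Proof.
move=> M0 r0 /andP[jt tj]; have t0 : 0 <= t by rewrite (le_trans _ (ltW jt)).
have s0 : 0 < t - j%:R by rewrite subr_gt0.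
have tE : frac t = t - j%:R by apply: fracE; rewrite (ltW jt).
pose rho := Num.sqrt ((t - j%:R) / n%:R).
transitivity (\int[lebesgue_Rn R n]_(x in cube n rho)
    ((M * (t - j%:R) `^ (- b)) `^ r)%:E)%E.
  rewrite [RHS]integral_mkcond; apply: eq_integral => x _.
  rewrite /source !patchE /paraboloids; case: ifPn => xc.
    by move: xc; rewrite inE/= tE => -[_ xc]; rewrite ifT// inE.
  rewrite ifF ?powR0 ?gt_eqF//; apply/negbTE; apply: contra xc.
  by rewrite !inE/= tE.
rewrite integral_cst; last exact: measurable_cube.
rewrite [X in (_ * X)%E]lebesgue_Rn_cube ?sqrtr_ge0// -EFinM; congr (_%:E).
rewrite powRM ?powR_ge0// -!mulrA; congr (_ * _).
rewrite -powRrM mulNr powRD; last by rewrite (gt_eqF s0) implybT.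
rewrite [LHS]mulrC [RHS]mulrA; congr (_ * _).
rewrite /rho sqrtrM ?(ltW s0)// sqrtrV// mulrCA mulrC exprMn; congr (_ * _).
by rewrite [n%:R / 2]mulrC powRrM powR_mulrn ?powR_ge0// powR12_sqrt// ltW.
Qed.

(** By Tonelli, a power of the source is integrable on a unit time slab when a
    power of [s] is integrable near 0. *)
Lemma integral_source_slab n (M b r : R) j : 0 <= M -> 0 < r ->
  (\int[lebesgue_Rnt R n]_(z in slab n j) (source M b z `^ r)%:E =
   (M `^ r * (2 / Num.sqrt n%:R) ^+ n)%:E *
   \int[mu]_(t in `[j%:R, (j%:R + 1)%R[)
      ((t - j%:R) `^ (n%:R / 2 - b * r))%:E)%E.
Proof.
move=> M0 r0; rewrite integral_mkcond /lebesgue_Rnt.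
have ms := @measurable_sourceX n M b r.
rewrite fubini_tonelli2; last 2 first.
- by apply/(measurable_restrictT _ (@measurable_slab n j)); exact: ms.
- by apply: erestrict_ge0 => z _; rewrite lee_fin powR_ge0.
rewrite natr1.
transitivity (\int[mu]_(t in `[j%:R, j.+1%:R[)
    \int[lebesgue_Rn R n]_x (source M b (x, t) `^ r)%:E)%E.
  rewrite [RHS]integral_mkcond; apply: eq_integral => t _.
  rewrite /fubini_G patchE; case: ifPn => tj.
    apply: eq_integral => x _; rewrite patchE ifT// inE.
  rewrite integral0_eq// => x _; rewrite patchE ifF//.
  by apply/negbTE; apply: contra tj; rewrite !inE.
have mpow : measurable_fun setT
    (fun t : R => ((t - j%:R) `^ (n%:R / 2 - b * r))%:E).
  by apply/measurable_EFinP; exact: measurable_powR_shift.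
have eqs t : t \in `]j%:R, j.+1%:R[%classic ->
    (\int[lebesgue_Rn R n]_x (source M b (x, t) `^ r)%:E =
    (M `^ r * (2 / Num.sqrt n%:R) ^+ n)%:E *
     ((t - j%:R) `^ (n%:R / 2 - b * r))%:E)%E.
  by rewrite inE/= in_itv/= -EFinM => tj; exact: integral_source_section.
(* The section formula needs s > 0; the endpoint s = 0 is negligible. *)
rewrite !(integral_itv_bndoo true true).
- rewrite -ge0_integralZl//; first exact: eq_integral.
  + exact: measurable_funTS.
  + by move=> t _; rewrite lee_fin powR_ge0.
  + by rewrite lee_fin mulr_ge0 ?powR_ge0 ?exprn_ge0 ?divr_ge0 ?sqrtr_ge0.
- exact: measurable_funTS.
- apply: (eq_measurable_fun _ (fun t tj => esym (eqs t tj))).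
  by apply: measurable_funeM; exact: measurable_funTS.
Qed.

Lemma integral_source_slab_lty n (M b r : R) j : 0 <= M -> 0 < r ->
  -1 < n%:R / 2 - b * r ->
  (\int[lebesgue_Rnt R n]_(z in slab n j) (source M b z `^ r)%:E < +oo)%E.
Proof.
move=> M0 r0 br; rewrite integral_source_slab// lte_mul_pinfty//.
  by rewrite lee_fin mulr_ge0 ?powR_ge0 ?exprn_ge0 ?divr_ge0 ?sqrtr_ge0.
by apply: le_lt_trans (integral_powR_le br _) _; rewrite ?ltrDl ?ltry.
Qed.

Lemma integral_source_slab_infty n (M b r : R) j :
  (0 < n)%N -> 0 < M -> 0 < r ->
  n%:R / 2 - b * r <= -1 ->
  (\int[lebesgue_Rnt R n]_(z in slab n j) (source M b z `^ r)%:E = +oo)%E.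
Proof.
move=> n0 M0 r0 br; rewrite integral_source_slab ?(ltW M0)//.
rewrite integral_powR_infty// gt0_muley// lte_fin mulr_gt0 ?powR_gt0//.
by rewrite exprn_gt0// divr_gt0 ?sqrtr_gt0 ?ltr0n.
Qed.

(** Only finitely many unit slabs meet the support before a given time. *)
Lemma integral_source_before_lty n (M b r T : R) : 0 <= M -> 0 < r ->
  -1 < n%:R / 2 - b * r ->
  (\int[lebesgue_Rnt R n]_(z in before T) (source M b z `^ r)%:E < +oo)%E.
Proof.
move=> M0 r0 br.
have ms := @measurable_sourceX n M b r.
have ge0 (z : Rnt R n) : (0 <= (source M b z `^ r)%:E)%E.
  by rewrite lee_fin powR_ge0.
suff main N : (\int[lebesgue_Rnt R n]_(z in before N%:R)
    (source M b z `^ r)%:E < +oo)%E.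
  apply: le_lt_trans (main (Num.truncn T).+1).
  apply: ge0_subset_integral => //.
  - exact: measurable_before.
  - exact: measurable_before.
  by move=> z /=; rewrite /before/= => zT; exact: lt_trans zT (truncnS_gt _).
elim: N => [|N IH].
  rewrite integral0_eq// => z z0.
  by rewrite source_lt0// powR0// gt_eqF.
have -> : @before R n N.+1%:R = before N%:R `|` slab n N.
  apply/seteqP; split => z; rewrite /before /slab/=.
    by move=> ->; rewrite andbT; case: ltP; [left|right].
  by case=> [h|/andP[]//]; rewrite (lt_le_trans h)// ler_nat.
rewrite ge0_integral_setU//.
- by apply: lte_add_pinfty => //; exact: integral_source_slab_lty.
- exact: measurable_before.
- exact: measurable_slab.
- apply/disj_setPS => z []; rewrite /before /slab/= => h /andP[h' _].
  by rewrite leNgt h in h'.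
Qed.

End source_integrals.

(** * The potential of a nonnegative function *)

Lemma lebesgue_Rnt_sigma_finite (R : realType) n :
  sigma_finite setT (lebesgue_Rnt R n).
Proof.
have /sigma_finiteP[F [TF ndF Foo]] := sigma_finiteT (lebesgue_Rn R n).
have /sigma_finiteP[G [TG ndG Goo]] := sigma_finiteT (@lebesgue_measure R).
exists (fun k => F k `*` G k).
  apply/seteqP; split => // -[x y] _.
  have [k _ Fk] : (\bigcup_k F k) x by rewrite -TF.
  have [l _ Gl] : (\bigcup_k G k) y by rewrite -TG.
  exists (maxn k l) => //; split => /=.
  - by move: x Fk; exact/subsetPset/ndF/leq_maxl.
  - by move: y Gl; exact/subsetPset/ndG/leq_maxr.
move=> k; have [mF Fk] := Foo k; have [mG Gk] := Goo k.
split; first exact: measurableX.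
by rewrite /lebesgue_Rnt/= product_measure1E// lte_mul_pinfty// ge0_fin_numE.
Qed.

(** Lebesgue measure on space-time once more, now carrying its sigma-finiteness:
    Tonelli's theorem is used on the product of space-time with itself. *)
Definition lebesgue_Rnt_sf (R : realType) n :
    {sigma_finite_measure set (Rnt R n) -> \bar R} :=
  HB.pack (Measure.sort (lebesgue_Rnt R n))
    (Measure_isSigmaFinite.Build _ _ _ (lebesgue_Rnt R n)
      (@lebesgue_Rnt_sigma_finite R n)).

Section potential.
Context {R : realType} (n : nat) (alpha : R).
Hypothesis alpha0 : 0 < alpha.
Notation mu := (@lebesgue_measure R).
Notation nu := (lebesgue_Rnt R n).
Implicit Types (z w : Rnt R n) (f : Rnt R n -> R).

Notation sigma_nu := (lebesgue_Rnt_sf R n).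

Lemma Phi_ge0 (x : Rn R n) t : 0 <= Phi alpha x t.
Proof.
rewrite /Phi; case: ifP => // _.
by rewrite mulr_ge0 ?expR_ge0// mulr_ge0 ?invr_ge0 ?powR_ge0// divr_ge0
  ?powR_ge0// ltW// Gamma_gt0.
Qed.

Lemma measurable_heat_kernel : measurable_fun setT
  (fun zw : Rnt R n * Rnt R n =>
     Phi alpha (subRn zw.1.1 zw.2.1) (zw.1.2 - zw.2.2 : R)).
Proof.
have mt : measurable_fun setT
    (fun zw : Rnt R n * Rnt R n => zw.1.2 - zw.2.2 : R).
  by apply: measurable_funB; apply: (measurableT_comp measurable_snd).
have mx i : measurable_fun setT
    (fun zw : Rnt R n * Rnt R n => tnth zw.1.1 i - tnth zw.2.1 i : R).
  by apply: measurable_funB;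
    apply: (measurableT_comp (@measurable_coord R n i)).
(* Where the kernel is nonzero, its reciprocals are real powers. *)
have -> : (fun zw : Rnt R n * Rnt R n =>
      Phi alpha (subRn zw.1.1 zw.2.1) (zw.1.2 - zw.2.2 : R)) =
    (fun zw => let t := zw.1.2 - zw.2.2 : R in if 0 < t then
      t `^ (alpha - 1) / Gamma alpha * (4 * pi * t) `^ (- (n%:R / 2)) *
      expR (- (enorm (subRn zw.1.1 zw.2.1) ^+ 2 * (4 * t) `^ (- 1))) else 0).
  apply/funext => zw; rewrite /Phi /=; case: ifPn => // t0.
  by rewrite powRN powR_inv1// mulr_ge0// ltW.
apply: measurable_fun_ifT => //=.
  exact: measurable_fun_ltr.
apply: measurable_funM; first apply: measurable_funM.
- apply: measurable_funM => //.
  exact: (measurableT_comp (measurable_powR _) mt).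
- apply: (measurableT_comp (measurable_powR _)).
  exact: measurable_funM.
- apply: (measurableT_comp (@measurable_expR R)).
  apply: measurable_funN.
  apply: measurable_funM.
    apply: measurable_funX; apply: measurable_sqrt.
    apply: measurable_sum => i; apply: measurable_funX.
    by under eq_fun do rewrite tnth_mktuple; exact: mx.
  apply: (measurableT_comp (measurable_powR _)).
  exact: measurable_funM.
Qed.

Definition heat_integrand f (zw : Rnt R n * Rnt R n) : \bar R :=
  (Phi alpha (subRn zw.1.1 zw.2.1) (zw.1.2 - zw.2.2 : R) * f zw.2)%:E.

Lemma measurable_heat_integrand f : measurable_fun setT f ->
  measurable_fun setT (heat_integrand f).
Proof.
move=> mf; apply/measurable_EFinP; apply: measurable_funM.
  exact: measurable_heat_kernel.
exact: (measurableT_comp mf measurable_snd).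
Qed.

(** The kernel vanishes at nonpositive times, so the integral may be taken over
    all of space-time; its integrand is then jointly measurable. *)
Lemma JE f z : J alpha f z = (\int[nu]_w heat_integrand f (z, w))%E.
Proof.
rewrite /J integral_mkcond; apply: eq_integral => w _.
rewrite patchE; case: ifPn => // /negP wz.
rewrite /heat_integrand /Phi ifF ?mul0r//.
by apply/negbTE/negP; rewrite subr_gt0 => h; apply: wz; rewrite inE.
Qed.

Section nonnegative.
Variable f : Rnt R n -> R.
Hypotheses (mf : measurable_fun setT f) (f0 : forall z, 0 <= f z).

Lemma heat_integrand_ge0 zw : (0 <= heat_integrand f zw)%E.
Proof. by rewrite lee_fin mulr_ge0 ?Phi_ge0. Qed.

Lemma J_ge0 z : (0 <= J alpha f z)%E.
Proof.
by rewrite JE; apply: integral_ge0 => w _; exact: heat_integrand_ge0.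
Qed.

Lemma measurable_J : measurable_fun setT (J alpha f).
Proof.
have -> : J alpha f = fubini_F sigma_nu (heat_integrand f).
  by apply/funext => z; rewrite JE.
exact: (measurable_fun_fubini_tonelli_F (m2 := sigma_nu) (heat_integrand f)
  (measurable_heat_integrand mf) heat_integrand_ge0).
Qed.

End nonnegative.

(** In space the kernel at time [s] has mass [s ^ (alpha - 1) / Gamma alpha];
    integrate this in [s]. *)
Lemma integral_heat_kernel_le w (T : R) : (w.2 : R) < T ->
  (\int[nu]_(z in before T) (Phi alpha (subRn z.1 w.1) (z.2 - w.2 : R))%:E
    <= ((T - w.2) `^ alpha / alpha / Gamma alpha)%:E)%E.
Proof.
move=> wT; rewrite integral_mkcond.
set K := (_ \_ _).
have mK : measurable_fun setT K.
  apply/(measurable_restrictT _ (@measurable_before R n T)).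
  apply: measurable_funTS; apply/measurable_EFinP.
  exact: (measurableT_comp measurable_heat_kernel (pair2_measurable w)).
have K0 z : (0 <= K z)%E.
  by apply: erestrict_ge0 => {}z _; rewrite lee_fin Phi_ge0.
have mpow (D : set R) :
    measurable_fun D (fun t : R => ((t - w.2) `^ (alpha - 1))%:E).
  by apply/measurable_EFinP; exact: measurable_powR_shift.
rewrite /lebesgue_Rnt fubini_tonelli2//.
apply: (@le_trans _ _ (\int[mu]_(t in `[(w.2 : R), T[)
    ((Gamma alpha)^-1%:E * ((t - w.2) `^ (alpha - 1))%:E))%E).
  rewrite [leRHS]integral_mkcond; apply: ge0_le_integral => //.
  - by move=> t _; apply: integral_ge0.
  - exact: measurable_fun_fubini_tonelli_G.
  - apply/(measurable_restrictT _ (measurable_itv _)).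
    by apply: measurable_funeM; exact: mpow.
  - move=> t _; rewrite /fubini_G patchE.
    have [wt|tw] := ltP (w.2 : R) t; last first.
      rewrite integral0_eq//.
        case: ifP => // _; rewrite -EFinM lee_fin mulr_ge0 ?powR_ge0//.
        by rewrite invr_ge0 ltW// Gamma_gt0.
      by move=> x _; rewrite /K patchE; case: ifP => // _;
        rewrite /Phi subr_gt0 ltNge tw.
    have [tT|Tt] := ltP t T; last first.
      rewrite ifF; last first.
        by apply/negbTE; rewrite notin_setE/= in_itv/= (ltNge t) Tt andbF.
      rewrite integral0_eq// => x _; rewrite /K patchE ifF//; apply/negbTE.
      by rewrite notin_setE /before/= ltNge Tt.
    rewrite ifT; last by rewrite inE/= in_itv/= (ltW wt).
    rewrite (_ : (\int[lebesgue_Rn R n]_x K (x, t))%E =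
        (\int[lebesgue_Rn R n]_x (Phi alpha (subRn x w.1) (t - w.2))%:E)%E).
      by rewrite integral_Phi ?subr_gt0// -EFinM mulrC.
    by apply: eq_integral => x _; rewrite /K patchE ifT// inE.
rewrite ge0_integralZl//; last 3 first.
- exact: mpow.
- by move=> t _; rewrite lee_fin powR_ge0.
- by rewrite lee_fin invr_ge0 ltW// Gamma_gt0.
rewrite [leRHS]EFinM muleC.
rewrite lee_wpmul2r ?lee_fin ?invr_ge0 ?(ltW (Gamma_gt0 _))//.
have := @integral_powR_le R (alpha - 1) w.2 T; rewrite subrK; apply => //.
by rewrite ltrBrDl subrr.
Qed.

(** By Tonelli, the integral of [J f] before time [N] is that of [f] against the
    mass of the kernel before time [N], bounded on the support of [f]. *)
Lemma J_ae_lty f : measurable_fun setT f -> (forall z, 0 <= f z) ->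
  (forall z, (z.2 : R) < 0 -> f z = 0) ->
  (forall T : R, \int[nu]_(z in before T) (f z)%:E < +oo)%E ->
  {ae nu, forall z, (J alpha f z < +oo)%E}.
Proof.
move=> mf f0 fneg fint.
have mJ := measurable_J mf f0.
have J0 := J_ge0 f0.
suff main (N : nat) : (\int[nu]_(z in before N%:R) J alpha f z < +oo)%E.
  have : {ae nu, forall z, forall N : nat,
      before N%:R z -> J alpha f z \is a fin_num}.
    apply: ae_foralln => N.
    apply: integrable_ae; first exact: measurable_before.
    apply/integrableP; split; first exact: measurable_funTS.
    by under eq_integral do rewrite gee0_abs//.
  apply: filterS => z /(_ (Num.truncn (z.2 : R)).+1).
  by rewrite ge0_fin_numE//; apply; exact: truncnS_gt.
pose K (zw : Rnt R n * Rnt R n) :=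
  (heat_integrand f \_ (fun zw => before N%:R zw.1)) zw.
pose c := N%:R `^ alpha / alpha / Gamma alpha.
have c0 : 0 <= c.
  by rewrite divr_ge0 ?(ltW (Gamma_gt0 _))// divr_ge0 ?powR_ge0// ltW.
have mB : measurable (fun zw : Rnt R n * Rnt R n => before N%:R zw.1).
  rewrite -[X in measurable X]setTI.
  exact: (measurable_fst _ _ (@measurable_before R n N%:R)).
have mK : measurable_fun setT K.
  apply/(measurable_restrictT _ mB); apply: measurable_funTS.
  exact: measurable_heat_integrand.
have K0 zw : (0 <= K zw)%E.
  by apply: erestrict_ge0 => {}zw _; exact: heat_integrand_ge0.
have -> : (\int[nu]_(z in before N%:R) J alpha f z =
    \int[nu]_z \int[nu]_w K (z, w))%E.
  rewrite integral_mkcond; apply: eq_integral => z _.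
  rewrite patchE; case: ifPn => zN.
    rewrite JE; apply: eq_integral => w _; rewrite /K patchE ifT//.
  rewrite integral0_eq// => w _; rewrite /K patchE ifF//.
  by apply/negbTE; apply: contra zN; rewrite !inE.
rewrite (fubini_tonelli (m1 := sigma_nu) (m2 := sigma_nu) K mK K0).
apply: (@le_lt_trans _ _ (\int[nu]_(w in before N%:R) (c%:E * (f w)%:E))%E).
  rewrite [leRHS]integral_mkcond; apply: ge0_le_integral => //.
  - by move=> w _; exact: integral_ge0.
  - exact: measurable_fun_fubini_tonelli_G.
  - apply/(measurable_restrictT _ (@measurable_before R n _)).
    apply: measurable_funTS; apply: measurable_funeM; exact/measurable_EFinP.
  move=> w _.
  have -> : (\int[nu]_z K (z, w) = (f w)%:E *
      \int[nu]_(z in before N%:R)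
        (Phi alpha (subRn z.1 w.1) (z.2 - w.2 : R))%:E)%E.
    rewrite -ge0_integralZl//.
    - rewrite [RHS]integral_mkcond; apply: eq_integral => z _.
      rewrite /K !patchE; case: ifPn => zN; last rewrite ifF//.
        rewrite ifT; last by move: zN; rewrite !inE.
        by rewrite /heat_integrand/= EFinM muleC.
      by apply/negbTE; apply: contra zN; rewrite !inE.
    - exact: measurable_before.
    - apply: measurable_funTS; apply/measurable_EFinP.
      exact: (measurableT_comp measurable_heat_kernel (pair2_measurable w)).
    - by move=> z _; rewrite lee_fin Phi_ge0.
    - by rewrite lee_fin.
  have [w0|w0] := ltP (w.2 : R) 0.
    rewrite fneg// mul0e patchE; case: ifP => // _.
    by rewrite mule_ge0 ?lee_fin.
  rewrite patchE; case: ifPn => wN; last first.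
    rewrite [X in (_ * X)%E]integral0_eq ?mule0// => z zN.
    rewrite /Phi ifF//; apply/negbTE; rewrite subr_gt0 -leNgt.
    apply: le_trans (ltW zN) _.
    by move: wN; rewrite notin_setE /before/= => /negP; rewrite -leNgt.
  rewrite inE in wN; rewrite muleC lee_wpmul2r ?lee_fin//.
  apply: le_trans (integral_heat_kernel_le wN) _.
  rewrite lee_fin /c -!mulrA ler_wpM2r//.
    by rewrite divr_ge0 ?invr_ge0 ?(ltW alpha0)// ltW// Gamma_gt0.
  apply: ge0_ler_powR; rewrite ?nnegrE ?subr_ge0 ?(ltW alpha0)//.
  - exact: ltW.
  - by rewrite gerBl.
rewrite ge0_integralZl//; last 3 first.
- exact: measurable_before.
- by apply/measurable_EFinP; exact: measurable_funTS.
- by move=> w _; rewrite lee_fin.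
by rewrite lte_mul_pinfty// ?lee_fin.
Qed.

End potential.

(** * Lower bound for the potential of the source *)

Section lower_bound.
Context {R : realType} (n : nat) (alpha M b : R).
Hypotheses (n0 : (0 < n)%N) (alpha0 : 0 < alpha) (M0 : 0 <= M) (b0 : 0 <= b).
Notation nu := (lebesgue_Rnt R n).

(** The constant in [J_source_ge], collected from the lower bound [Phi_ge] and
    the volume of the region of integration. *)
Definition reproduction_const : R :=
  2^-1 `^ alpha / Gamma alpha * (Num.sqrt (4 * pi * n%:R))^-1 ^+ n *
  expR (- 2) / 4.

Lemma reproduction_const_gt0 : 0 < reproduction_const.
Proof.
rewrite divr_gt0// mulr_gt0 ?expR_gt0// mulr_gt0//.
  by rewrite divr_gt0 ?powR_gt0 ?invr_gt0// Gamma_gt0.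
by rewrite exprn_gt0// invr_gt0 sqrtr_gt0 !mulr_gt0 ?pi_gt0// ltr0n.
Qed.

(** On the parabolic scale [s], i.e. for times comparable to [s] and points at
    distance at most a multiple of [sqrt s], the heat kernel is at least a
    constant times [s ^ (alpha - 1 - n / 2)]. *)
Lemma Phi_ge (x : Rn R n) s theta :
  0 < s -> s / 2 <= theta -> theta <= s -> enorm x ^+ 2 <= 4 * s ->
  (s / 2) `^ alpha / s / Gamma alpha * (Num.sqrt (4 * pi * s))^-1 ^+ n *
    expR (- 2) <= Phi alpha x theta.
Proof.
move=> s0 s2 ts xs.
have t0 : 0 < theta by apply: lt_le_trans s2; rewrite divr_gt0.
have p0 : 0 < 4 * pi :> R by rewrite mulr_gt0 ?pi_gt0.
have G0 := Gamma_gt0 alpha0.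
rewrite /Phi t0; apply: ler_pM.
- rewrite mulr_ge0 ?exprn_ge0 ?invr_ge0 ?sqrtr_ge0//.
  by rewrite divr_ge0 ?divr_ge0 ?powR_ge0 ?(ltW s0)// ltW.
- exact: expR_ge0.
- apply: ler_pM.
  + by rewrite divr_ge0 ?divr_ge0 ?powR_ge0 ?(ltW s0)// ltW.
  + by rewrite exprn_ge0// invr_ge0 sqrtr_ge0.
  + rewrite ler_pM2r ?invr_gt0//.
    (* theta^alpha / theta is bounded below factor by factor, whatever the
       sign of alpha - 1. *)
    rewrite powRB; last by rewrite (gt_eqF t0) implybT.
    rewrite powRr1 ?(ltW t0)//; apply: ler_pM.
    * exact: powR_ge0.
    * by rewrite invr_ge0 ltW.
    * by apply: ge0_ler_powR;
        rewrite ?nnegrE ?divr_ge0 ?(ltW alpha0) ?(ltW s0) ?(ltW t0).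
    * by rewrite lef_pV2 ?posrE.
  + rewrite exprVn lef_pV2 ?posrE ?exprn_gt0 ?powR_gt0 ?sqrtr_gt0
      ?mulr_gt0 ?pi_gt0//.
    rewrite [n%:R / 2]mulrC powRrM powR_mulrn ?powR_ge0//.
    rewrite powR12_sqrt ?mulr_ge0 ?pi_ge0 ?(ltW t0)//.
    apply: lerXn2r; rewrite ?nnegrE ?sqrtr_ge0//.
    by rewrite ler_wsqrtr// ler_pM2l.
- rewrite ler_expR lerN2 ler_pdivrMr ?mulr_gt0//.
  apply: le_trans xs _; lra.
Qed.

Lemma enorm_subRn_le (x y : Rn R n) s : 0 < s ->
  cube n (Num.sqrt (s / n%:R)) x -> cube n (Num.sqrt (s / n%:R) / 2) y ->
  enorm (subRn x y) ^+ 2 <= 4 * s.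
Proof.
move=> s0 cx cy; set rho := Num.sqrt _ in cx cy.
have rho0 : 0 <= rho by exact: sqrtr_ge0.
rewrite /enorm sqr_sqrtr; last by apply: sumr_ge0 => i _; exact: sqr_ge0.
apply: (@le_trans _ _ (\sum_(i < n) 4 * (s / n%:R))).
  apply: ler_sum => i _; rewrite tnth_mktuple.
  have -> : 4 * (s / n%:R) = (2 * rho) ^+ 2.
    by rewrite exprMn sqr_sqrtr ?divr_ge0 ?(ltW s0)//; ring.
  rewrite -real_normK ?num_real// lerXn2r ?nnegrE ?mulr_ge0//.
  apply: le_trans (ler_normB _ _) _.
  have := ltW (cx i); have := ltW (cy i); lra.
rewrite sumr_const card_ord -[leLHS]mulr_natr -mulrA divfK//.
by rewrite pnatr_eq0 -lt0n.
Qed.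

(** Looking back from time [t] by between one half and three quarters of the
    time [frac t] elapsed since the vertex, one stays in the same slab, and
    the half-size cube stays in the paraboloid. *)
Lemma source_ge (w : Rnt R n) (t : R) : 0 <= t -> 0 < frac t ->
  cube n (Num.sqrt (frac t / n%:R) / 2) w.1 ->
  t - 3 / 4 * frac t < (w.2 : R) < t - frac t / 2 ->
  M * frac t `^ (- b) <= source M b w.
Proof.
move=> t0 s0 cw /andP[tw wt].
have := truncn_itv t0; set j := Num.truncn t => /andP[jt tj].
have sE : frac t = t - j%:R by [].
have jw : j%:R <= (w.2 : R) by apply: ltW; lra.
have wj : (w.2 : R) < j.+1%:R by apply: lt_trans tj; lra.
have wE : frac w.2 = (w.2 : R) - j%:R by apply: fracE; rewrite jw.
have w0 : 0 < frac w.2 by rewrite wE; lra.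
rewrite /source patchE ifT; last first.
  rewrite inE; split => /=; first by apply: le_trans jw.
  move=> i; apply: lt_le_trans (cw i) _.
  have -> : Num.sqrt (frac t / n%:R) / 2 = Num.sqrt (frac t / 4 / n%:R).
    rewrite (_ : frac t / 4 / n%:R = (2^-1) ^+ 2 * (frac t / n%:R)); last first.
      by rewrite exprVn mulrCA mulrA; congr (_ / _ / _); ring.
    by rewrite [RHS]sqrtrM ?sqr_ge0// sqrtr_sqr ger0_norm// mulrC.
  rewrite ler_wsqrtr// ler_wpM2r ?invr_ge0//; lra.
rewrite ler_wpM2l// !powRN lef_pV2 ?posrE ?powR_gt0//.
apply: ge0_ler_powR; rewrite ?nnegrE ?(ltW s0) ?(ltW w0)//; lra.
Qed.

(** Keep in [J] only the contribution of the half-size cube over the times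
    allowed by [source_ge]: there the integrand is at least a constant times
    [s ^ (alpha - 1 - n / 2 - b)], and the region has volume a constant times
    [s ^ (1 + n / 2)]. So [J] raises the exponent [- b] by [alpha], as the
    parabolic scaling predicts. *)
Lemma J_source_ge (z : Rnt R n) : paraboloids n z -> 0 < frac z.2 ->
  ((reproduction_const * M * frac z.2 `^ (alpha - b))%:E
    <= J alpha (source M b) z)%E.
Proof.
move=> [z0 cz] s0; set s := frac z.2 in s0 cz *.
pose rho := Num.sqrt (s / n%:R) / 2.
have rho0 : 0 <= rho by rewrite divr_ge0 ?sqrtr_ge0.
pose I : set R := [set` `](z.2 - 3 / 4 * s : R), (z.2 - s / 2 : R)[].
pose E := cube n rho `*` I.
have mI : measurable I by exact: measurable_itv.
have mE : measurable E by apply: measurableX => //; exact: measurable_cube.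
pose A := (s / 2) `^ alpha / s / Gamma alpha * (Num.sqrt (4 * pi * s))^-1 ^+ n *
    expR (- 2) * (M * s `^ (- b)).
have A0 : 0 <= A.
  by rewrite !mulr_ge0 ?exprn_ge0 ?invr_ge0 ?powR_ge0 ?expR_ge0 ?sqrtr_ge0
    ?(ltW s0) ?(ltW (Gamma_gt0 _)).
have muE : nu E = (s / 4 * (Num.sqrt (s / n%:R)) ^+ n)%:E.
  rewrite /lebesgue_Rnt [LHS]product_measure1E//; last exact: measurable_cube.
  rewrite [X in (X * _)%E](@lebesgue_Rn_cube R n)//.
  rewrite [X in (_ * X)%E]lebesgue_measure_itv/=.
  rewrite lte_fin ifT; last by lra.
  rewrite -EFinD -EFinM /rho; congr (_%:E).
  rewrite mulrC; congr (_ * _ ^+ _); lra.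
have -> : reproduction_const * M * s `^ (alpha - b) =
    A * (s / 4 * (Num.sqrt (s / n%:R)) ^+ n).
  have p0 : 0 < 4 * pi :> R by rewrite mulr_gt0 ?pi_gt0.
  have sn : Num.sqrt (s / n%:R) ^+ n =
      (Num.sqrt (4 * pi * n%:R))^-1 ^+ n * Num.sqrt (4 * pi * s) ^+ n.
    rewrite -exprMn; congr (_ ^+ _).
    rewrite -sqrtrV ?mulr_ge0 ?pi_ge0// -sqrtrM ?invr_ge0 ?mulr_ge0 ?pi_ge0//.
    apply: (congr1 (@Num.sqrt R)).
    by rewrite invfM mulrACA mulVf ?gt_eqF// mul1r mulrC.
  have s4 : Num.sqrt (4 * pi * s) ^+ n != 0.
    by rewrite gt_eqF// exprn_gt0// sqrtr_gt0 mulr_gt0.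
  rewrite sn /A /reproduction_const powRM ?(ltW s0)//.
  rewrite powRD; last by rewrite (gt_eqF s0) implybT.
  have n4 : Num.sqrt (4 * pi * n%:R) ^+ n != 0 :> R.
    by rewrite gt_eqF// exprn_gt0// sqrtr_gt0 mulr_gt0// ltr0n.
  by rewrite !exprVn; field; rewrite n4 s4 !gt_eqF ?Gamma_gt0.
rewrite EFinM -muE -(integral_cst nu mE) JE.
have mint : measurable_fun setT
    (fun w => heat_integrand alpha (source M b) (z, w)).
  apply: (measurableT_comp (measurable_heat_integrand _ _)
    (pair1_measurable z)).
  exact: measurable_source.
have int0 w : (0 <= heat_integrand alpha (source M b) (z, w))%E.
  by rewrite heat_integrand_ge0// => {}w; exact: source_ge0.
apply: (@le_trans _ _
    (\int[nu]_(w in E) heat_integrand alpha (source M b) (z, w))%E).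
  apply: ge0_le_integral => //.
  - exact: measurable_funTS.
  - move=> w [cw]; rewrite /I/= in_itv/= => /andP[w1 w2].
    rewrite lee_fin; apply: ler_pM.
    + by rewrite !mulr_ge0 ?exprn_ge0 ?invr_ge0 ?powR_ge0 ?expR_ge0 ?sqrtr_ge0
        ?(ltW s0) ?(ltW (Gamma_gt0 _)).
    + by rewrite mulr_ge0 ?powR_ge0.
    + apply: Phi_ge => //; [lra|lra|].
      exact: enorm_subRn_le.
    + by apply: source_ge => //; rewrite w1.
by apply: ge0_subset_integral.
Qed.

End lower_bound.

(** * Infinite norms *)

Section Lnorm_of_nonneg.
Context {R : realType} (n : nat).
Notation nu := (lebesgue_Rnt R n).
Implicit Types (f g : Rnt R n -> R) (D : set (Rnt R n)).

Lemma LnormOnE D f (r : R) : r != 0 -> (forall z, 0 <= f z) ->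
  LnormOn r%:E D f = ((\int[nu]_(z in D) (f z `^ r)%:E) `^ r^-1)%E.
Proof.
move=> r0 f0; rewrite /LnormOn unlock; congr (_ `^ _)%E.
rewrite [RHS]integral_mkcond; apply: eq_integral => z _.
rewrite /= !patchE; case: ifP => _.
  by rewrite ger0_norm.
by rewrite normr0 powR0.
Qed.

(** For finite [q] integrate the inequality between [f] and [g]. For infinite
    [q], a bound [f <= k] would give [f ^ q0 <= k ^ (q0 - p) * f ^ p], which is
    integrable on [D]. *)
Lemma LnormOn_infty D f g (p q0 : R) (q : \bar R) :
  measurable D -> measurable_fun setT f -> measurable_fun setT g ->
  (forall z, 0 <= f z) -> (forall z, 0 <= g z) ->
  {ae nu, forall z, f z <= g z} ->
  0 < p -> p <= q0 -> (q0%:E <= q)%E ->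
  (\int[nu]_(z in D) (f z `^ p)%:E < +oo)%E ->
  (forall r : R, (q0 <= r)%R -> \int[nu]_(z in D) (f z `^ r)%:E = +oo)%E ->
  LnormOn q D g = +oo%E.
Proof.
move=> mD mf mg f0 g0 fg p0 pq0 q0q fp fr.
have mX h (r : R) : measurable_fun setT h ->
    measurable_fun D (fun z : Rnt R n => (h z `^ r)%:E).
  move=> mh; apply/measurable_EFinP; apply: measurable_funTS.
  exact: (measurableT_comp (measurable_powR r) mh).
have q00 : 0 < q0 by apply: lt_le_trans pq0.
case: q q0q => [r| |]; last by rewrite leeNy_eq.
- rewrite lee_fin => q0r; have r0 : 0 < r by apply: lt_le_trans q0r.
  rewrite LnormOnE ?gt_eqF//; apply: eqy_poweR; first by rewrite invr_gt0.
  apply/eqP; rewrite -leye_eq -(fr r q0r).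
  apply: ae_ge0_le_integral => //.
  + by move=> z _; rewrite lee_fin powR_ge0.
  + exact: mX.
  + by move=> z _; rewrite lee_fin powR_ge0.
  + exact: mX.
  + apply: filterS fg => z fgz _; rewrite lee_fin.
    by apply: ge0_ler_powR; rewrite ?nnegrE ?(ltW r0).
- move=> _; rewrite /LnormOn unlock.
  have -> : (0 < nu setT)%E.
    rewrite lt0e measure_ge0 andbT; apply/eqP => nu0.
    have nuD : nu D = 0%E.
      by apply/eqP; rewrite -measure_le0 -nu0 le_measure ?inE.
    by have := fr q0 (lexx _); rewrite null_set_integral//; exact: mX.
  apply/eqP/negPn/negP; rewrite -ltey; set K := ess_sup _ _ => Ky.
  have [k Kk] : exists k : R, (K <= k%:E)%E.
    by move: Ky; case: K => [k| |] // _; [exists k|exists 0; rewrite leNye].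
  have /ess_supP gk := Kk.
  suff : (\int[nu]_(z in D) (f z `^ q0)%:E < +oo)%E by rewrite fr// ltxx.
  apply: (@le_lt_trans _ _
      ((k `^ (q0 - p))%:E * \int[nu]_(z in D) (f z `^ p)%:E)%E).
    rewrite -ge0_integralZl//; last 3 first.
    + exact: mX.
    + by move=> z _; rewrite lee_fin powR_ge0.
    + by rewrite lee_fin powR_ge0.
    apply: ae_ge0_le_integral => //.
    + by move=> z _; rewrite lee_fin powR_ge0.
    + exact: mX.
    + by move=> z _; rewrite -EFinM lee_fin mulr_ge0 ?powR_ge0.
    + by apply: measurable_funeM; exact: mX.
    + apply: filterS2 fg gk => z fgz + Dz.
      rewrite /= patchE mem_set//= lee_fin ger0_norm// => gk.
      rewrite -EFinM lee_fin.
      have [fz0|fz0] := eqVneq (f z) 0.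
        by rewrite fz0 powR0 ?gt_eqF// mulr_ge0 ?powR_ge0.
      rewrite -[in leLHS](subrK p q0) [leLHS]powRD; last by rewrite fz0 implybT.
      rewrite ler_wpM2r ?powR_ge0//; apply: ge0_ler_powR.
      * by rewrite subr_ge0.
      * by rewrite nnegrE.
      * by rewrite nnegrE (le_trans _ (le_trans fgz gk)).
      * exact: le_trans gk.
  by rewrite lte_mul_pinfty// lee_fin powR_ge0.
Qed.

End Lnorm_of_nonneg.

(** * The source on the parabolic boxes *)

Section source_support.
Context {R : realType} (n : nat).
Hypothesis n0 : (0 < n)%N.
Implicit Types (z : Rnt R n) (M b : R).

Lemma measurable_enorm : measurable_fun setT (@enorm R n).
Proof.
apply: measurable_sqrt; apply: measurable_sum => i; apply: measurable_funX.
exact: measurable_tnth.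
Qed.

Lemma measurable_parabolicBox (t : R) : measurable (@parabolicBox R n t).
Proof.
have -> : @parabolicBox R n t =
    [set z | enorm z.1 < Num.sqrt t] `&` snd @^-1` [set` `]t, (2 * t)[].
  by apply/seteqP; split => z; rewrite /parabolicBox /= in_itv.
apply: measurableI.
  apply: measurable_set_ltr => //.
  exact: (measurableT_comp measurable_enorm measurable_fst).
by rewrite -[X in measurable X]setTI; apply: measurable_snd.
Qed.

(** At the time of a vertex the cube has side 0, so it is empty as [n > 0]. *)
Lemma paraboloids_frac_gt0 z : paraboloids n z -> 0 < frac z.2.
Proof.
move=> [z0 cz]; have /andP[s0 _] := frac_itv z0.
rewrite lt0r s0 andbT; apply/eqP => s00.
have := le_lt_trans (normr_ge0 _) (cz (Ordinal n0)).
by rewrite s00 mul0r sqrtr0 ltxx.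
Qed.

Lemma paraboloids_enorm_lt1 z : paraboloids n z -> enorm z.1 < 1.
Proof.
move=> zP; have [z0 cz] := zP; have s0 := paraboloids_frac_gt0 zP.
have /andP[_ s1] := frac_itv z0.
rewrite -[ltRHS]sqrtr1 /enorm ltr_sqrt//; apply: le_lt_trans s1.
apply: (@le_trans _ _ (\sum_(i < n) frac z.2 / n%:R)).
  apply: ler_sum => i _; have /ltW := cz i.
  rewrite -(@ler_sqr _ `|_|) ?nnegrE ?sqrtr_ge0// real_normK ?num_real//.
  by rewrite sqr_sqrtr// divr_ge0// ltW.
rewrite sumr_const card_ord -[leLHS]mulr_natr divfK//.
by rewrite pnatr_eq0 -lt0n.
Qed.

(** The paraboloid with vertex [(0, j + 2)] has radius at most 1 and lasts one
    unit of time, so it fits in the parabolic box of parameter [j + 2]. *)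
Lemma slab_sub_parabolicBox M b (j : nat) z :
  slab n j.+2 z -> source M b z != 0 -> parabolicBox j.+2%:R z.
Proof.
move=> /andP[jz zj]; rewrite /source patchE; case: ifPn; rewrite ?eqxx// inE.
move=> zP _; have s0 := paraboloids_frac_gt0 zP; split.
  apply: lt_trans (paraboloids_enorm_lt1 zP) _.
  by rewrite -[ltLHS]sqrtr1 ltr_sqrt ?ltr0n// (ltr_nat _ 1).
apply/andP; split.
  by move: s0; rewrite (@fracE _ j.+2) ?jz// subr_gt0.
apply: lt_le_trans zj _.
by rewrite -natrM ler_nat mul2n -addnn addnS ltnS leq_addr.
Qed.

Lemma integral_source_parabolicBox_infty M b r (j : nat) : 0 < M -> 0 < r ->
  n%:R / 2 - b * r <= -1 ->
  (\int[lebesgue_Rnt R n]_(z in parabolicBox j.+2%:R) (source M b z `^ r)%:E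
    = +oo)%E.
Proof.
move=> M0 r0 br; apply/eqP; rewrite -leye_eq.
rewrite -(integral_source_slab_infty j.+2 n0 M0 r0 br).
rewrite integral_mkcond [leRHS]integral_mkcond; apply: ge0_le_integral => //.
- by move=> z _; apply: erestrict_ge0 => {}z _; rewrite lee_fin powR_ge0.
- apply/(measurable_restrictT _ (@measurable_slab R n j.+2)).
  exact: measurable_sourceX.
- apply/(measurable_restrictT _ (@measurable_parabolicBox j.+2%:R)).
  exact: measurable_sourceX.
- move=> z _; rewrite !patchE; case: ifPn => [|_]; last first.
    by case: ifPn => // _; rewrite lee_fin powR_ge0.
  rewrite inE => zj; have [->|fz] := eqVneq (source M b z) 0.
    by case: ifPn => // _; rewrite powR0 ?gt_eqF.
  by rewrite ifT// inE; exact: slab_sub_parabolicBox fz.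
Qed.

End source_support.

Theorem theorem3p6 (R : realType) (n : nat) (p alpha lambda : R) (q : \bar R)
  (hn : (1 <= n)%N)
  (hp : (1 < p /\ 0 < alpha < (n.+2)%:R / (2 * p)) \/
        (p = 1 /\ 0 < alpha <= (n.+2)%:R / (2 * p)))
  (hlambda : 1 < lambda)
  (halpha : 0 < alpha < (n.+2)%:R / (2 * p) * (1 - lambda^-1))
  (hq : (((n.+2)%:R / (2 * alpha) * (1 - lambda^-1))%:E <= q)%E) :
  exists u f : Rnt R n -> R,
    [/\ Yspace p alpha u,
        fracHeat p alpha u f,
        {ae lebesgue_Rnt R n, forall z, 0 <= f z <= u z `^ lambda},
        {ae lebesgue_Rnt R n, forall z, (z.2 : R) < 0 -> u z = 0} &
        exists t : nat -> R,
          [/\ forall j, 1 < t j,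
              t @ \oo --> +oo &
              forall j,
                LnormOn q (parabolicBox (t j)) (fun z => u z `^ lambda)
                  = +oo%E /\
                LnormOn q (parabolicBox (t j)) f = +oo%E]].
Proof.
have p1 : 1 <= p by case: hp => [[/ltW]|[->]].
have p0 : 0 < p by apply: lt_le_trans p1.
have /andP[alpha0 alpha_lt] := halpha.
have l0 : 0 < lambda by apply: lt_trans hlambda.
have l1 : 0 < lambda - 1 by rewrite subr_gt0.
(* The exponent b solves lambda * (alpha - b) = - b, so that (J f) ^ lambda has
   the homogeneity of f; M then solves (c * M) ^ lambda = M. *)
pose b := alpha * lambda / (lambda - 1).
have b0 : 0 < b by rewrite divr_gt0// mulr_gt0.
pose c := @reproduction_const R n alpha.
have c0 : 0 < c := reproduction_const_gt0 hn alpha0.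
pose M := c `^ (- (lambda / (lambda - 1))).
have M0 : 0 < M by rewrite powR_gt0.
pose q0 := (n.+2)%:R / (2 * alpha) * (1 - lambda^-1).
have n2 : n.+2%:R = n%:R + 2 :> R by rewrite -natrD addn2.
(* The source is locally in L^r exactly when b * r < (n + 2) / 2, which holds
   for r = p and fails from r = q0 on. *)
have bp : -1 < n%:R / 2 - b * p.
  have : b * p < n.+2%:R / 2.
    have -> : b = alpha / (1 - lambda^-1).
      by rewrite /b; field; rewrite !gt_eqF.
    have l2 : 0 < 1 - lambda^-1 by rewrite subr_gt0 invf_lt1.
    rewrite -ltr_pdivlMr// ltr_pdivrMr//.
    by rewrite (_ : n.+2%:R / 2 / p = n.+2%:R / (2 * p))// invfM mulrA.
  rewrite n2; lra.
have b1 : -1 < n%:R / 2 - b * 1.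
  by apply: lt_le_trans bp _; rewrite lerB// ler_wpM2l// ltW.
have bq0 : b * q0 = n.+2%:R / 2 by rewrite /b /q0; field; rewrite !gt_eqF.
have pq0 : p <= q0.
  rewrite -(ler_pM2l b0) bq0 n2; lra.
have q00 : 0 < q0 by apply: lt_le_trans pq0.
pose f : Rnt R n -> R := source M b.
pose u z := fine (J alpha f z).
have mf : measurable_fun setT f := @measurable_source R n M b.
have f0 z : 0 <= f z by apply: source_ge0; exact: ltW.
have fneg (z : Rnt R n) : (z.2 : R) < 0 -> f z = 0 by exact: source_lt0.
have J0 := J_ge0 alpha0 f0.
have u0 z : 0 <= u z by exact: fine_ge0.
have Jfin : {ae lebesgue_Rnt R n, forall z, (J alpha f z < +oo)%E}.
  apply: J_ae_lty => // T.
  under eq_integral => z _ do rewrite -[f z]powRr1//.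
  by apply: integral_source_before_lty => //; exact: ltW.
have meas_u : measurable_fun setT u.
  exact: (measurableT_comp (@fine_measurable R setT measurableT)
    (measurable_J alpha0 mf f0)).
have uJ : ae_J alpha f u.
  apply: filterS Jfin => z Jz; rewrite /u fineK// ge0_fin_numE//.
have Xf : Xspace p f.
  split => // T; rewrite LnormOnE ?gt_eqF//; apply: poweR_lty.
  by apply: integral_source_before_lty => //; exact: ltW.
have Yu : Yspace p alpha u by split => //; exists f.
have fu : {ae lebesgue_Rnt R n, forall z, f z <= u z `^ lambda}.
  apply: filterS uJ => z uz.
  rewrite {1}/f /source patchE; case: ifPn => [|_]; last exact: powR_ge0.
  rewrite inE => zP; have s0 := paraboloids_frac_gt0 hn zP.
  have := J_source_ge hn alpha0 (ltW M0) (ltW b0) zP s0.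
  rewrite -/f -uz lee_fin -/c => le_u.
  have -> : M * frac z.2 `^ (- b) =
      (c * M * frac z.2 `^ (alpha - b)) `^ lambda.
    have cM : (c * M) `^ lambda = M.
      rewrite -[X in (X * _) `^ _](powRr1 (ltW c0)) /M -powRD; last first.
        by rewrite (gt_eqF c0) implybT.
      by rewrite -powRrM; congr (_ `^ _); field; rewrite gt_eqF.
    transitivity ((c * M) `^ lambda * (frac z.2 `^ (alpha - b)) `^ lambda).
      rewrite cM -powRrM; congr (_ * _ `^ _).
      by rewrite /b; field; rewrite gt_eqF.
    by rewrite [RHS]powRM ?powR_ge0// mulr_ge0 ?ltW.
  apply: ge0_ler_powR => //; rewrite ?nnegrE ?(ltW l0)//.
  by rewrite mulr_ge0 ?powR_ge0// mulr_ge0 ?ltW.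
exists u, f; split => //.
- by apply: filterS fu => z fuz; rewrite f0.
- apply: nearW => z z0; rewrite /u /J integral0_eq// => w wz.
  by rewrite fneg ?mulr0//; exact: lt_trans z0.
- exists (fun j => j.+2%:R); split.
  + by move=> j; rewrite (ltr_nat _ 1).
  + have := @cvgr_idn R; rewrite -(cvg_shiftn 2) => h.
    apply: cvg_trans h; apply: near_eq_cvg.
    by apply: nearW => j; rewrite /= ?addn2.
  + move=> j.
    have mul : measurable_fun setT (fun z => u z `^ lambda).
      exact: (measurableT_comp (measurable_powR lambda) meas_u).
    have fp : (\int[lebesgue_Rnt R n]_(z in parabolicBox j.+2%:R)
        (f z `^ p)%:E < +oo)%E.
      apply: le_lt_trans (@integral_source_before_lty R n M b p (2 * j.+2%:R)
        (ltW M0) p0 bp).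
      apply: ge0_subset_integral => //.
      * exact: measurable_parabolicBox.
      * exact: measurable_before.
      * exact: measurable_sourceX.
      * by move=> z _; rewrite lee_fin powR_ge0.
      * by move=> z [_ /andP[_]].
    have fr (r : R) : q0 <= r ->
        (\int[lebesgue_Rnt R n]_(z in parabolicBox j.+2%:R)
          (f z `^ r)%:E = +oo)%E.
      move=> q0r; apply: integral_source_parabolicBox_infty => //.
        exact: lt_le_trans q0r.
      have : b * q0 <= b * r by rewrite ler_pM2l.
      rewrite bq0 n2; lra.
    split; apply: (LnormOn_infty _ mf _ f0 _ _ p0 pq0 hq fp fr) => //.
    * exact: measurable_parabolicBox.
    * by move=> z; exact: powR_ge0.
    * exact: measurable_parabolicBox.
    * exact: nearW.
Qed.
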